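(* Let $Q\subset\mathbb{R}^n$ be a nonempty convex compact set, and let $\widetilde g$ be an inexact oracle with fixed uncontrolled error $\delta_u>0$, i.e. for every $\delta_c>0$ a map $x\mapsto\widetilde g(x,\delta_c,\delta_u)$ from $Q$ to $\mathbb{R}^n$ is given and there is a constant $L(\delta_c)\in(0,+\infty)$ such that for all $x,y,z\in Q$ $$\langle\widetilde g(y,\delta_c,\delta_u)-\widetilde g(x,\delta_c,\delta_u),\,y-z\rangle\leqslant L(\delta_c)\left(V(y,x)+V(z,y)\right)+\delta_c+\delta_u.$$ Let $\varepsilon>0$ and $L^0>0$, and suppose that the inexact adaptive proximal mirror method (Algorithm 2, described in the context) stops after $N$ iterations, having produced the points $x^0,\dots,x^N\in Q$, $y^1,\dots,y^N\in Q$ and the constants $L^1,\dots,L^N>0$. Put $S_N=\sum_{k=0}^{N-1}\frac{1}{L^{k+1}}$. Then for every $x\in Q$ $$\frac{1}{S_N}\sum_{k=0}^{N-1}\frac{1}{L^{k+1}}\left\langle\widetilde g\left(y^{k+1},\tfrac{\varepsilon}{2},\delta_u\right),\,y^{k+1}-x\right\rangle\leqslant\frac{V(x,x^0)-V(x,x^N)}{S_N}+\frac{\varepsilon}{2}+\delta_u.$$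
   Context: $\mathbb{R}^n$ is equipped with a norm $\|\cdot\|$ (not necessarily Euclidean), and $\langle\cdot,\cdot\rangle$ is the scalar product on $\mathbb{R}^n$. A function $d$ is fixed which is $1$-strongly convex on $Q$ with respect to $\|\cdot\|$ and differentiable at every point of $Q$. The Bregman divergence is $$V(x,y)=d(x)-d(y)-\langle\nabla d(y),x-y\rangle,\qquad x,y\in Q.$$ Algorithm 2 (inexact adaptive proximal mirror method). Input: accuracy $\varepsilon>0$, initial constant $L^0>0$, starting point $x^0=\arg\min_{x\in Q}d(x)$. The oracle is used with controlled error $\delta_c=\varepsilon/2$. Put $R^2=\max_{x\in Q}V(x,x^0)$. For $k=0,1,2,\dots$ the iteration passing from $x^k$ to $x^{k+1}$ is as follows. 1. Set $L^{k+1}:=L^k/2$. 2. Compute $$y^{k+1}:=\arg\min_{x\in Q}\left\{\left\langle\widetilde g\left(x^k,\tfrac{\varepsilon}{2},\delta_u\right),x-x^k\right\rangle+L^{k+1}V(x,x^k)\right\},$$ $$x^{k+1}:=\arg\min_{x\in Q}\left\{\left\langle\widetilde g\left(y^{k+1},\tfrac{\varepsilon}{2},\delta_u\right),x-x^k\right\rangle+L^{k+1}V(x,x^k)\right\}.$$ 3. If $$\left\langle\widetilde g\left(y^{k+1},\tfrac{\varepsilon}{2},\delta_u\right)-\widetilde g\left(x^k,\tfrac{\varepsilon}{2},\delta_u\right),\,y^{k+1}-x^{k+1}\right\rangle\leqslant L^{k+1}V(y^{k+1},x^k)+L^{k+1}V(x^{k+1},y^{k+1})+\frac{\varepsilon}{2}+\delta_u,$$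 the iteration is completed, with the current $y^{k+1},x^{k+1},L^{k+1}$. 4. Otherwise set $L^{k+1}:=2L^{k+1}$ and return to step 2. Stopping criterion: the method stops after $N$ completed iterations, where $N\geqslant1$ is the first number for which $\sum_{k=0}^{N-1}\frac{1}{L^{k+1}}\geqslant\frac{2R^2}{\varepsilon}$. *)

(* Defs.v *)
(* R^n is the type of row vectors 'rV[R]_n. *)
From HB Require Import structures.
From mathcomp Require Import all_boot all_order all_algebra.
From mathcomp Require Import all_classical all_reals.
From mathcomp Require Import topology normedtype derive convex.

Set Implicit Arguments.
Unset Strict Implicit.
Unset Printing Implicit Defensive.

Import Order.TTheory GRing.Theory Num.Theory.
Import numFieldNormedType.Exports.
Local Open Scope classical_set_scope.
Local Open Scope ring_scope.

(* An arbitrary norm on R^n, independent of the sup norm `|x| that 'rV[R]_n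
   carries in the library; the topology is the same for all of them. *)
Record is_norm (R : realType) (n : nat) (nm : 'rV[R]_n -> R) : Prop := IsNorm {
  norm_triangle : forall u v, nm (u + v) <= nm u + nm v;
  norm_homogeneous : forall (a : R) u, nm (a *: u) = `|a| * nm u;
  norm_definite : forall u, nm u = 0 -> u = 0
}.

Definition dot (R : realType) (n : nat) (u v : 'rV[R]_n) : R :=
  \sum_(i < n) u 0 i * v 0 i.

Definition grad (R : realType) (n : nat) (f : 'rV[R]_n -> R) (y : 'rV[R]_n) :
    'rV[R]_n :=
  \row_(i < n) 'D_(delta_mx 0 i) f y.

Definition strongly_convex (R : realType) (n : nat) (nm : 'rV[R]_n -> R)
    (mu : R) (Q : set 'rV[R]_n) (f : 'rV[R]_n -> R) : Prop :=
  forall (x y : 'rV[R]_n) (t : R), Q x -> Q y -> 0 <= t -> t <= 1 ->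
    f (t *: x + (1 - t) *: y) <=
      t * f x + (1 - t) * f y - mu / 2 * t * (1 - t) * nm (x - y) ^+ 2.

Definition bregman (R : realType) (n : nat) (d : 'rV[R]_n -> R)
    (x y : 'rV[R]_n) : R :=
  d x - d y - dot (grad d y) (x - y).

Definition is_argmin (R : realType) (T : Type) (Q : set T) (f : T -> R)
    (u : T) : Prop :=
  Q u /\ forall x, Q x -> f u <= f x.

Definition is_max (R : realType) (T : Type) (Q : set T) (f : T -> R)
    (M : R) : Prop :=
  (exists2 x, Q x & f x = M) /\ forall x, Q x -> f x <= M.

(* [g x dc du] is the oracle answer at x with controlled error dc and
   uncontrolled error du; values outside Q or for dc <= 0 are irrelevant. *)
Definition inexact_oracle (R : realType) (n : nat) (Q : set 'rV[R]_n)
    (d : 'rV[R]_n -> R) (g : 'rV[R]_n -> R -> R -> 'rV[R]_n) (du : R) : Prop :=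
  forall dc : R, 0 < dc -> exists2 L : R, 0 < L &
    forall x y z : 'rV[R]_n, Q x -> Q y -> Q z ->
      dot (g y dc du - g x dc du) (y - z) <=
        L * (bregman d y x + bregman d z y) + dc + du.

Definition prox_step (R : realType) (n : nat) (Q : set 'rV[R]_n)
    (d : 'rV[R]_n -> R) (v xk : 'rV[R]_n) (L : R) (u : 'rV[R]_n) : Prop :=
  is_argmin Q (fun x => dot v (x - xk) + L * bregman d x xk) u.

Definition trial (R : realType) (n : nat) (Q : set 'rV[R]_n)
    (d : 'rV[R]_n -> R) (g : 'rV[R]_n -> R -> R -> 'rV[R]_n) (eps du : R)
    (xk : 'rV[R]_n) (L : R) (y x : 'rV[R]_n) : Prop :=
  prox_step Q d (g xk (eps / 2) du) xk L y /\
  prox_step Q d (g y (eps / 2) du) xk L x.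

Definition accepted (R : realType) (n : nat) (d : 'rV[R]_n -> R)
    (g : 'rV[R]_n -> R -> R -> 'rV[R]_n) (eps du : R)
    (xk : 'rV[R]_n) (L : R) (y x : 'rV[R]_n) : Prop :=
  dot (g y (eps / 2) du - g xk (eps / 2) du) (y - x) <=
    L * bregman d y xk + L * bregman d x y + eps / 2 + du.

(* [inner_loop xk L y' x' L'] says that, entered with
   the trial constant L, it ends with the points y', x' and the constant L'. *)
Inductive inner_loop (R : realType) (n : nat) (Q : set 'rV[R]_n)
    (d : 'rV[R]_n -> R) (g : 'rV[R]_n -> R -> R -> 'rV[R]_n) (eps du : R)
    (xk : 'rV[R]_n) : R -> 'rV[R]_n -> 'rV[R]_n -> R -> Prop :=
| inner_accept L y x :
    trial Q d g eps du xk L y x -> accepted d g eps du xk L y x ->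
    inner_loop Q d g eps du xk L y x L
| inner_reject L y x y' x' L' :
    trial Q d g eps du xk L y x -> ~ accepted d g eps du xk L y x ->
    inner_loop Q d g eps du xk (2 * L) y' x' L' ->
    inner_loop Q d g eps du xk L y' x' L'.

Definition inv_sum (R : realType) (L : nat -> R) (N : nat) : R :=
  \sum_(0 <= k < N) 1 / L k.+1.

(* [R2] stands for the squared radius R^2 itself. *)
Definition stops_at (R : realType) (n : nat) (Q : set 'rV[R]_n)
    (d : 'rV[R]_n -> R) (eps : R) (x0 : 'rV[R]_n) (L : nat -> R) (N : nat) :
    Prop :=
  exists2 R2 : R, is_max Q (fun x => bregman d x x0) R2 &
    [/\ (1 <= N)%N,
        inv_sum L N >= 2 * R2 / eps
      & forall m : nat, (1 <= m < N)%N -> inv_sum L m < 2 * R2 / eps].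

(* Run of the method stopped after N iterations. Only x 0, ..., x N,
   y 1, ..., y N and L 0, ..., L N are constrained. *)
Record mirror_prox_run (R : realType) (n : nat) (Q : set 'rV[R]_n)
    (d : 'rV[R]_n -> R) (g : 'rV[R]_n -> R -> R -> 'rV[R]_n) (eps du L0 : R)
    (N : nat) (x y : nat -> 'rV[R]_n) (L : nat -> R) : Prop := MirrorProxRun {
  run_start : is_argmin Q d (x 0%N);
  run_const : L 0%N = L0;
  run_iter : forall k : nat, (k < N)%N ->
    inner_loop Q d g eps du (x k) (L k / 2) (y k.+1) (x k.+1) (L k.+1);
  run_stop : stops_at Q d eps (x 0%N) L N
}.

(* Main.v *)
Require Import Defs.
From HB Require Import structures.
From mathcomp Require Import all_boot all_order all_algebra.
From mathcomp Require Import all_classical all_reals.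
From mathcomp Require Import topology normedtype derive convex.
From mathcomp Require Import interval_inference ring lra.

Set Implicit Arguments.
Unset Strict Implicit.

Import Order.TTheory GRing.Theory Num.Theory.
Import numFieldNormedType.Exports.
Local Open Scope classical_set_scope.
Local Open Scope ring_scope.

(** The estimate combines the optimality of the two proximal steps with the
    acceptance test. If [p] minimises [<v, . - xk> + L V(., xk)] over the
    convex set [Q], the one-sided derivative at [p] towards any [z] of [Q] is nonnegative;
    by the three-point identity of the Bregman divergence this reads
    [<v, p - z> <= L (V(z, xk) - V(z, p) - V(p, xk))] ([prox_step_le]).

    For an accepted iteration, write
    [<g(y), y - u> = <g(xk), y - x'> + <g(y), x' - u> + <g(y) - g(xk), y - x'>].
    The first two terms are bounded by [prox_step_le], applied to the step
    defining [y] with [z = x'] and to the step defining [x'] with [z = u]; the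
    third one by the acceptance test. All divergences cancel except
    [L (V(u, xk) - V(u, x'))], which leaves [accepted_step_le]. Dividing by [L]
    and summing over the iterations, these differences telescope. *)

Lemma dotDl (R : realType) (n : nat) (u v w : 'rV[R]_n) :
  dot (u + v) w = dot u w + dot v w.
Proof.
by rewrite /dot -big_split; apply: eq_bigr => i _; rewrite mxE mulrDl.
Qed.

Lemma dotDr (R : realType) (n : nat) (u v w : 'rV[R]_n) :
  dot w (u + v) = dot w u + dot w v.
Proof.
by rewrite /dot -big_split; apply: eq_bigr => i _; rewrite mxE mulrDr.
Qed.

Lemma dotZr (R : realType) (n : nat) (a : R) (u v : 'rV[R]_n) :
  dot u (a *: v) = a * dot u v.
Proof.
by rewrite /dot mulr_sumr; apply: eq_bigr => i _; rewrite mxE mulrCA.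
Qed.

Lemma dotNl (R : realType) (n : nat) (u v : 'rV[R]_n) :
  dot (- u) v = - dot u v.
Proof.
by rewrite /dot -sumrN; apply: eq_bigr => i _; rewrite mxE mulNr.
Qed.

Lemma dotNr (R : realType) (n : nat) (u v : 'rV[R]_n) :
  dot u (- v) = - dot u v.
Proof. by rewrite -scaleN1r dotZr mulN1r. Qed.

Lemma dot_grad (R : realType) (n : nat) (d : 'rV[R]_n -> R) (u w : 'rV[R]_n) :
  differentiable d u -> dot (grad d u) w = 'D_w d u.
Proof.
move=> du; rewrite deriveE// [in RHS](row_sum_delta w) linear_sum /dot.
by apply: eq_bigr => i _; rewrite mxE deriveE// linearZ /= mulrC.
Qed.

(** The difference quotients of [d] at [u] tend to the directional derivative,
    so a lower bound on them for small positive steps passes to the limit. *)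
Lemma dot_grad_ge (R : realType) (n : nat) (d : 'rV[R]_n -> R)
    (u w : 'rV[R]_n) (c : R) :
  differentiable d u ->
  (forall t, 0 < t -> t <= 1 -> t * c <= d (t *: w + u) - d u) ->
  c <= dot (grad d u) w.
Proof.
move=> du le_dc; rewrite dot_grad//.
have /cvg_dnbhs_at_right dD : (fun h : R =>
    h^-1 *: ((d \o shift u) (h *: w) - d u)) @ 0^' --> 'D_w d u.
  exact: diff_derivable.
apply: (cvgr_to_ge dD).
near=> t.
have t0 : 0 < t by near: t; exact: nbhs_right_gt.
have t1 : t <= 1 by near: t; exact: nbhs_right_le.
by rewrite /= /GRing.scale/= ler_pdivlMl//; exact: le_dc.
Unshelve. all: by end_near.
Qed.

Lemma convex_set_segment (R : realType) (n : nat) (Q : set 'rV[R]_n)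
    (u z : 'rV[R]_n) (t : R) :
  convex_set Q -> Q u -> Q z -> 0 <= t -> t <= 1 -> Q (t *: (z - u) + u).
Proof.
move=> cQ /mem_set Qu /mem_set Qz t0 t1.
have t01 : 0 <= t <= 1 by rewrite t0 t1.
have := cQ z u (Itv01 t0 t1) Qz Qu; rewrite inE; congr Q.
by rewrite /conv/= scalerBr scalerBl scale1r -addrA (addrC u).
Qed.

Lemma bregman_three_point (R : realType) (n : nat) (d : 'rV[R]_n -> R)
    (z p q : 'rV[R]_n) :
  bregman d z q - bregman d z p - bregman d p q =
  dot (grad d p) (z - p) - dot (grad d q) (z - p).
Proof. by rewrite /bregman !dotDr !dotNr; ring. Qed.

(** First-order optimality of [p] along the segment from [p] to [z], where the
    objective is [L d] plus an affine function, rewritten by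
    [bregman_three_point]. *)
Lemma prox_step_le (R : realType) (n : nat) (Q : set 'rV[R]_n)
    (d : 'rV[R]_n -> R) (v q p z : 'rV[R]_n) (L : R) :
  convex_set Q -> differentiable d p -> 0 < L ->
  prox_step Q d v q L p -> Q z ->
  dot v (p - z) <= L * (bregman d z q - bregman d z p - bregman d p q).
Proof.
move=> cQ dp L0 [Qp pmin] Qz.
have quot_ge (t : R) : 0 < t -> t <= 1 ->
    t * (dot (grad d q) (z - p) - dot v (z - p) / L) <=
    d (t *: (z - p) + p) - d p.
  move=> t0 t1.
  have := pmin _ (convex_set_segment cQ Qp Qz (ltW t0) t1).
  rewrite /bregman -!(addrA (t *: _)) !(dotDr (t *: _)) !dotZr => pmin_t.
  rewrite -(ler_pM2l L0).
  have -> : L * (t * (dot (grad d q) (z - p) - dot v (z - p) / L)) =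
     L * t * dot (grad d q) (z - p) - t * dot v (z - p).
    by field; rewrite gt_eqF.
  by lra.
have := dot_grad_ge dp quot_ge.
rewrite -(ler_pM2l L0) mulrBr mulrCA divff ?gt_eqF// mulr1.
by rewrite bregman_three_point -(opprB z p) dotNr; lra.
Qed.

(** Since [x] is a competitor in the step producing [y], the optimality of [y]
    controls [<g(xk), y - x>]; the term [- V(x, y) - V(y, xk)] it contributes
    pays exactly for the divergences on the right of the acceptance test, and
    [V(x, xk)] cancels with the optimality of [x]. *)
Lemma accepted_step_le (R : realType) (n : nat) (Q : set 'rV[R]_n)
    (d : 'rV[R]_n -> R) (g : 'rV[R]_n -> R -> R -> 'rV[R]_n) (eps du : R)
    (xk y x u : 'rV[R]_n) (L : R) :
  convex_set Q -> (forall p, Q p -> differentiable d p) -> 0 < L ->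
  trial Q d g eps du xk L y x -> accepted d g eps du xk L y x -> Q u ->
  dot (g y (eps / 2) du) (y - u) <=
    L * (bregman d u xk - bregman d u x) + (eps / 2 + du).
Proof.
move=> cQ dQ L0 [ystep xstep] acc Qu.
have [Qy Qx] := (ystep.1, xstep.1).
have := prox_step_le cQ (dQ _ Qy) L0 ystep Qx.
have := prox_step_le cQ (dQ _ Qx) L0 xstep Qu.
by move: acc; rewrite /accepted !dotDl !dotNl !dotDr !dotNr; lra.
Qed.

Lemma inner_loop_accepted (R : realType) (n : nat) (Q : set 'rV[R]_n)
    (d : 'rV[R]_n -> R) (g : 'rV[R]_n -> R -> R -> 'rV[R]_n) (eps du : R)
    (xk y x : 'rV[R]_n) (L L' : R) :
  inner_loop Q d g eps du xk L y x L' -> 0 < L ->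
  [/\ 0 < L', trial Q d g eps du xk L' y x & accepted d g eps du xk L' y x].
Proof.
elim=> [//|{}L y' x' y1 x1 L1 _ _ _ IH L0].
by apply: IH; rewrite mulr_gt0.
Qed.

Lemma run_const_gt0 (R : realType) (n : nat) (Q : set 'rV[R]_n)
    (d : 'rV[R]_n -> R) (g : 'rV[R]_n -> R -> R -> 'rV[R]_n) (eps du L0 : R)
    (N : nat) (x y : nat -> 'rV[R]_n) (L : nat -> R) (k : nat) :
  0 < L0 -> mirror_prox_run Q d g eps du L0 N x y L -> (k <= N)%N -> 0 < L k.
Proof.
move=> L0_gt0 run; elim: k => [_|k IH ltkN]; first by rewrite (run_const run).
have [|//] := inner_loop_accepted (run_iter run ltkN).
by rewrite divr_gt0// IH// ltnW.
Qed.

(** [accepted_step_le] divided by [L k.+1] makes the divergences telescope,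
    while the constant errors collect the weight [inv_sum L N]. *)
Lemma run_sum_le (R : realType) (n : nat) (Q : set 'rV[R]_n)
    (d : 'rV[R]_n -> R) (g : 'rV[R]_n -> R -> R -> 'rV[R]_n) (eps du L0 : R)
    (N : nat) (x y : nat -> 'rV[R]_n) (L : nat -> R) (u : 'rV[R]_n) :
  convex_set Q -> (forall p, Q p -> differentiable d p) -> 0 < L0 ->
  mirror_prox_run Q d g eps du L0 N x y L -> Q u ->
  \sum_(0 <= k < N) 1 / L k.+1 * dot (g (y k.+1) (eps / 2) du) (y k.+1 - u)
  <= bregman d u (x 0%N) - bregman d u (x N) + (eps / 2 + du) * inv_sum L N.
Proof.
move=> cQ dQ L0_gt0 run Qu.
rewrite -opprB -(telescope_sumr (fun k => bregman d u (x k)))// -sumrN.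
rewrite mulr_sumr -big_split/= !big_nat; apply: ler_sum => k /andP[_ ltkN].
have Lk : 0 < L k / 2.
  by rewrite divr_gt0// (run_const_gt0 L0_gt0 run)// ltnW.
have [L_gt0 tr acc] := inner_loop_accepted (run_iter run ltkN) Lk.
rewrite mul1r ler_pdivrMl//.
apply: (le_trans (accepted_step_le cQ dQ L_gt0 tr acc Qu)).
by rewrite [leRHS]mulrDr mulrCA divff ?gt_eqF// mulr1 opprB.
Qed.

Unset Implicit Arguments.
Set Strict Implicit.

Theorem mainTheorem3 (R : realType) (n : nat)
    (nm : 'rV[R]_n -> R) (Q : set 'rV[R]_n) (d : 'rV[R]_n -> R)
    (g : 'rV[R]_n -> R -> R -> 'rV[R]_n) (du eps L0 : R)
    (N : nat) (x y : nat -> 'rV[R]_n) (L : nat -> R) :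
  is_norm nm ->
  Q !=set0 -> convex_set Q -> compact Q ->
  strongly_convex nm 1 Q d ->
  (forall u : 'rV[R]_n, Q u -> differentiable d u) ->
  0 < du ->
  inexact_oracle Q d g du ->
  0 < eps -> 0 < L0 ->
  mirror_prox_run Q d g eps du L0 N x y L ->
  forall u : 'rV[R]_n, Q u ->
    1 / inv_sum L N *
      (\sum_(0 <= k < N)
         1 / L k.+1 * dot (g (y k.+1) (eps / 2) du) (y k.+1 - u))
    <= (bregman d u (x 0%N) - bregman d u (x N)) / inv_sum L N + eps / 2 + du.
Proof.
move=> _ _ cQ _ _ dQ _ _ _ L0_gt0 run u Qu.
have SN_gt0 : 0 < inv_sum L N.
  have [_ _ [N_gt0 _ _]] := run_stop run.
  rewrite /inv_sum big_mkord (bigD1 (Ordinal N_gt0))//=.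
  have L_gt0 (k : 'I_N) : 0 < 1 / L k.+1.
    by rewrite divr_gt0// (run_const_gt0 L0_gt0 run).
  by rewrite ltr_wpDr ?sumr_ge0 ?(L_gt0 (Ordinal N_gt0))// => k _; exact/ltW.
rewrite mul1r ler_pdivrMl// -addrA mulrDr mulrCA divff ?gt_eqF// mulr1.
rewrite (mulrC (inv_sum L N)).
exact: run_sum_le cQ dQ L0_gt0 run Qu.
Qed.
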